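(* Let $\mathcal{H}$ be an infinite-dimensional separable real Hilbert space with unit sphere $\mathcal{S} = \{x \in \mathcal{H} : \|x\| = 1\}$. Let $n \geq 1$, let $x_1, \ldots, x_n \in \mathcal{S}$, and let $u$ be any element of $\mathrm{span}(x_1,\ldots,x_n)^\perp \cap \mathcal{S}$. For any continuous function $\phi : [0,\pi] \to \mathbb{R}$, define $$F_\phi^{(n)}(s) = n^{-1} \sum_{i=1}^n \phi\{d_{\mathcal{S}}(s,x_i)\}, \qquad s \in \mathcal{S}.$$ Then: (1) A minimiser $\hat{s}$ of $F_\phi^{(n)}$ over $\mathcal{S}$ exists and can be found within the finite-dimensional subsphere $\mathrm{span}(u, x_1, \ldots, x_n) \cap \mathcal{S}$; that is, there exists $\hat{s} \in \mathrm{span}(u,x_1,\ldots,x_n) \cap \mathcal{S}$ with $F_\phi^{(n)}(\hat{s}) = \inf_{s \in \mathcal{S}} F_\phi^{(n)}(s)$. (2) In particular, for any real $p > 0$, finding a sample $L^p$ centre of mass, i.e. a minimiser over $\mathcal{S}$ of $s \mapsto n^{-1}\sum_{i=1}^n d_{\mathcal{S}}(s,x_i)^p$, is an optimisation over a manifold of dimension at most $n$: a minimiser over $\mathcal{S}$ exists in the sphere $\mathrm{span}(u,x_1,\ldots,x_n)\cap\mathcal{S}$, whose manifold dimension is at most $n$. (3) If $\langle \hat{s}, u\rangle \neq 0$ for some minimiser $\hat{s} \in \mathcal{S}$ of $F_\phi^{(n)}$ over $\mathcal{S}$, then $F_\phi^{(n)}$ has multiple minimisers over $\mathcal{S}$.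
   Context: The inner product and norm of $\mathcal{H}$ are $\langle \cdot,\cdot\rangle$ and $\|\cdot\| = \langle\cdot,\cdot\rangle^{1/2}$. The sphere $\mathcal{S}$ carries the great-arc distance $d_{\mathcal{S}}(x,x') = \arccos(\langle x,x'\rangle) \in [0,\pi]$. The manifold dimension of the unit sphere of a $k$-dimensional subspace is $k-1$. *)

(* Defs.v *)
From HB Require Import structures.
From mathcomp Require Import all_boot all_order all_algebra.
From mathcomp Require Import all_classical all_reals all_analysis.

Set Implicit Arguments.
Unset Strict Implicit.
Unset Printing Implicit Defensive.

Import Order.TTheory GRing.Theory Num.Theory.
Import numFieldNormedType.Exports.

Local Open Scope classical_set_scope.
Local Open Scope ring_scope.

(* [{dot H for idfun}] is the type of symmetric positive definite bilinear
   forms on [H]; completeness is inherited from [completeNormedModType]. *)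
HB.mixin Record isHilbert (R : realType) H of CompleteNormedModule R H := {
  inner : {dot H for (@idfun R)} ;
  hilbert_normE : forall x : H, `|x| = Num.sqrt (inner x x)
}.

#[short(type="hilbertType")]
HB.structure Definition Hilbert (R : realType) :=
  {H of isHilbert R H & CompleteNormedModule R H}.

Notation "''<' x , y >" := (inner x y)
  (at level 0, x at level 69, y at level 69, format "''<' x ,  y >") :
  ring_scope.

Definition separable (T : topologicalType) : Prop :=
  exists2 D : set T, countable D & dense D.

Section LinearSpan.
Context {K : fieldType} {V : lmodType K}.

Definition linspan (A : set V) : set V :=
  [set v | exists (k : nat) (w : 'I_k -> V) (c : 'I_k -> K),
     (forall i, A (w i)) /\ v = \sum_(i < k) c i *: w i].

Definition linearly_independent (k : nat) (b : 'I_k -> V) : Prop :=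
  forall c : 'I_k -> K, \sum_(i < k) c i *: b i = 0 -> forall i, c i = 0.

Definition subspace_dim (k : nat) (W : set V) : Prop :=
  exists2 b : 'I_k -> V, linearly_independent b & W = linspan (range b).

End LinearSpan.

Definition infinite_dimensional (K : fieldType) (V : lmodType K) : Prop :=
  ~ exists2 A : set V, finite_set A & linspan A = [set: V].

Definition minimiser (T : Type) (R : realType) (f : T -> R) (S : set T)
    (s : T) : Prop :=
  S s /\ forall t, S t -> f s <= f t.

Section Sphere.
Context {R : realType} {H : hilbertType R}.

Definition unit_sphere : set H := [set x | `|x| = 1].

Definition orthocomp (A : set H) : set H :=
  [set v | forall a, A a -> '<v, a> = 0].

Definition arc_dist (x y : H) : R := acos '<x, y>.

(* [Y] has manifold dimension [m] as a sphere: it is the unit sphere of an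
   [(m + 1)]-dimensional subspace. *)
Definition sphere_dim (m : nat) (Y : set H) : Prop :=
  exists2 W : set H, subspace_dim m.+1 W & Y = W `&` unit_sphere.

(* Only the values of [phi] on [0, pi] matter when [s] and the [x i] are unit
   vectors, so [phi : [0, pi] -> R] is represented by a total function. *)
Definition frechet_fun (n : nat) (x : 'I_n -> H) (phi : R -> R) (s : H) : R :=
  n%:R^-1 * \sum_(i < n) phi (arc_dist s (x i)).

Definition Lp_centre_of_mass (n : nat) (x : 'I_n -> H) (p : R) (s : H) : Prop :=
  minimiser (fun s' => n%:R^-1 * \sum_(i < n) arc_dist s' (x i) `^ p)
    unit_sphere s.

End Sphere.
Arguments unit_sphere {R} H.

(* Main.v *)
(* F(s) depends on s only through the inner products with the x_i, hence only
   on the orthogonal projection P s onto span(x_1, ..., x_n).  The unit vector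
   P s + sqrt(1 - |P s|^2) u has the same projection and lies in
   span(u, x_1, ..., x_n), so minimising F over the whole sphere reduces to that
   subsphere; an orthonormal basis identifies it with a Euclidean sphere, which
   is compact.  For (3), reflecting a minimiser in the hyperplane orthogonal to u
   changes no inner product with the x_i. *)
Require Import Defs.
From mathcomp Require Import all_boot all_order all_algebra.
From mathcomp Require Import all_classical all_reals all_analysis.
From mathcomp Require Import ring lra.

Set Implicit Arguments.
Unset Strict Implicit.
Unset Printing Implicit Defensive.

Import Order.TTheory GRing.Theory Num.Theory.
Import numFieldNormedType.Exports.

Local Open Scope classical_set_scope.
Local Open Scope ring_scope.

(** * Closure properties of linear spans *)

Section LinearSpanTheory.
Context {K : fieldType} {V : lmodType K}.
Implicit Types (A B : set V) (v w : V).

Lemma subset_linspan A : A `<=` linspan A.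
Proof.
move=> v Av; exists 1, (fun=> v), (fun=> 1); split=> //.
by rewrite big_ord1 scale1r.
Qed.

Lemma linspan0 A : linspan A 0.
Proof. by exists 0, (fun=> 0), (fun=> 0); split=> [[]//|]; rewrite big_ord0. Qed.

Lemma linspanZ A a v : linspan A v -> linspan A (a *: v).
Proof.
move=> [k [w [c [Aw ->]]]]; exists k, w, (fun i => a * c i); split=> //.
by rewrite scaler_sumr; apply: eq_bigr => i _; rewrite scalerA.
Qed.

Lemma linspanD A v w : linspan A v -> linspan A w -> linspan A (v + w).
Proof.
move=> [k [w1 [c1 [Aw1 ->]]]] [l [w2 [c2 [Aw2 ->]]]].
exists (k + l)%N, (fun i => match fintype.split i with inl j => w1 j | inr j => w2 j end),
  (fun i => match fintype.split i with inl j => c1 j | inr j => c2 j end).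
split=> [i|]; first by case: (fintype.split i).
rewrite big_split_ord /=; congr (_ + _); apply: eq_bigr => i _.
  by have /= -> := unsplitK (inl i : 'I_k + 'I_l).
by have /= -> := unsplitK (inr i : 'I_k + 'I_l).
Qed.

Lemma linspan_sum A (I : finType) (c : I -> K) (w : I -> V) :
  (forall i, linspan A (w i)) -> linspan A (\sum_i c i *: w i).
Proof.
move=> Aw; apply: big_ind; [exact: linspan0|exact: linspanD|].
by move=> i _; exact: linspanZ.
Qed.

Lemma linspan_subset A B : A `<=` linspan B -> linspan A `<=` linspan B.
Proof. by move=> AB v [k [w [c [Aw ->]]]]; apply: linspan_sum => i; exact/AB. Qed.

(** Generators from [A] lie in the span of [B] and conversely, so either may replace the other
    beside [C]. This lets an orthonormal family stand in for the [x i] while [u] is kept. *)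
Lemma linspan_setU A B C : linspan A = linspan B ->
  linspan (C `|` A) = linspan (C `|` B).
Proof.
have sub (A' B' : set V) : linspan A' = linspan B' ->
    linspan (C `|` A') `<=` linspan (C `|` B').
  move=> eqAB; apply: linspan_subset => v [Cv|Av].
    by apply: subset_linspan; left.
  have : linspan B' v by rewrite -eqAB; exact: subset_linspan.
  by apply: linspan_subset => w Bw; apply: subset_linspan; right.
by move=> eqAB; apply/seteqP; split; exact: sub.
Qed.

Lemma linspan_setU_id A v : linspan A v -> linspan (v |` A) = linspan A.
Proof.
move=> Av; apply/seteqP; split; apply: linspan_subset => w.
  by case=> [->//|]; exact: subset_linspan.
by move=> Aw; apply: subset_linspan; right.
Qed.

End LinearSpanTheory.

(** * Prepending an element to a finite family *)

Definition fcons (T : Type) (k : nat) (v : T) (e : 'I_k -> T) (i : 'I_k.+1) : T :=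
  oapp e v (unlift ord0 i).

Lemma fcons0 (T : Type) k (v : T) (e : 'I_k -> T) : fcons v e ord0 = v.
Proof. by rewrite /fcons unlift_none. Qed.

Lemma fcons_lift (T : Type) k (v : T) (e : 'I_k -> T) i :
  fcons v e (lift ord0 i) = e i.
Proof. by rewrite /fcons liftK. Qed.

Lemma range_fcons (T : Type) k (v : T) (e : 'I_k -> T) :
  range (fcons v e) = v |` range e.
Proof.
apply/seteqP; split=> w.
  move=> [i _ <-]; case: (unliftP ord0 i) => [j|] ->; rewrite ?fcons0 ?fcons_lift.
    by right; exists j.
  by left.
move=> [->|[j _ <-]]; first by exists ord0; rewrite ?fcons0.
by exists (lift ord0 j); rewrite ?fcons_lift.
Qed.

Lemma fcons_eta (T : Type) k (x : 'I_k.+1 -> T) :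
  x = fcons (x ord0) (fun i => x (lift ord0 i)).
Proof.
by apply: funext => i; case: (unliftP ord0 i) => [j|] ->;
  rewrite ?fcons0 ?fcons_lift.
Qed.

(** * Inner products, orthogonal projection and Gram-Schmidt *)

Section Orthonormal.
Context {R : realType} {H : hilbertType R}.
Implicit Types (u v w : H).

Lemma innerC u v : '<u, v> = '<v, u>.
Proof. by rewrite hermC expr0 mul1r. Qed.

Lemma innerZl a u v : '<a *: u, v> = a * '<u, v>.
Proof. exact: linearZl_LR. Qed.

Lemma innerZr a u v : '<u, a *: v> = a * '<u, v>.
Proof. by rewrite innerC innerZl innerC. Qed.

Lemma innerDl u v w : '<u + v, w> = '<u, w> + '<v, w>.
Proof. exact: linearDl. Qed.

Lemma innerBl u v w : '<u - v, w> = '<u, w> - '<v, w>.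
Proof. exact: linearBl. Qed.

Lemma inner0l u : '<0, u> = 0.
Proof. exact: linear0l. Qed.

Lemma inner_suml (I : finType) (f : I -> H) u :
  '<\sum_i f i, u> = \sum_i '<f i, u>.
Proof. exact: linear_sumlz. Qed.

Lemma innerDr u v w : '<w, u + v> = '<w, u> + '<w, v>.
Proof. exact: linearDr. Qed.

Lemma innerBr u v w : '<w, u - v> = '<w, u> - '<w, v>.
Proof. exact: linearBr. Qed.

Lemma inner_sumr (I : finType) (f : I -> H) u :
  '<u, \sum_i f i> = \sum_i '<u, f i>.
Proof. exact: linear_sumr. Qed.

Lemma inner_gt0 u : u != 0 -> 0 < '<u, u>.
Proof. exact: neq0_dnorm_gt0. Qed.

Lemma inner_ge0 u : 0 <= '<u, u>.
Proof. by have [->|/inner_gt0/ltW//] := eqVneq u 0; rewrite inner0l. Qed.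

Lemma unit_sphereE u : unit_sphere H u = ('<u, u> = 1).
Proof.
rewrite /unit_sphere /= hilbert_normE; apply/propext; split=> [u1|->].
  by rewrite -(sqr_sqrtr (inner_ge0 u)) u1 expr1n.
by rewrite sqrtr1.
Qed.

(** Cauchy-Schwarz for unit vectors: the squared norms of [u + v] and [u - v] are [2 + 2 * '<u, v>]
    and [2 - 2 * '<u, v>], both nonnegative. *)
Lemma unit_inner_itv u v : unit_sphere H u -> unit_sphere H v ->
  -1 <= '<u, v> <= 1.
Proof.
rewrite !unit_sphereE => u1 v1.
have := inner_ge0 (u + v); have := inner_ge0 (u - v).
rewrite innerBl !innerBr innerDl !innerDr /= u1 v1 (innerC v u).
set t := '<u, v>; lra.
Qed.

Definition orthonormal_family k (e : 'I_k -> H) : Prop :=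
  forall i j, '<e i, e j> = (i == j)%:R.

(** For orthonormal [e] this is the orthogonal projection of [v] onto the span of [e]. *)
Definition orthoproj k (e : 'I_k -> H) v : H := \sum_(i < k) '<v, e i> *: e i.

Section Family.
Context {k : nat} {e : 'I_k -> H} (orth_e : orthonormal_family e).

Lemma inner_comb (c : 'I_k -> R) j : '<\sum_(i < k) c i *: e i, e j> = c j.
Proof.
rewrite inner_suml (bigD1 j)//= innerZl orth_e eqxx mulr1 big1 ?addr0//.
by move=> i ij; rewrite innerZl orth_e (negbTE ij) mulr0.
Qed.

Lemma inner_comb2 (c d : 'I_k -> R) :
  '<\sum_(i < k) c i *: e i, \sum_(i < k) d i *: e i> = \sum_(i < k) c i * d i.
Proof.
rewrite inner_sumr; apply: eq_bigr => j _.
by rewrite innerZr inner_comb mulrC.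
Qed.

Lemma inner_orthoproj v w : '<orthoproj e v, w> = '<v, orthoproj e w>.
Proof.
rewrite inner_suml inner_sumr; apply: eq_bigr => j _.
by rewrite innerZl innerZr (innerC w) mulrC.
Qed.

Lemma orthoproj_inner v j : '<orthoproj e v, e j> = '<v, e j>.
Proof. exact: inner_comb. Qed.

Lemma orthoproj_idem v : orthoproj e (orthoproj e v) = orthoproj e v.
Proof. by apply: eq_bigr => i _; rewrite orthoproj_inner. Qed.

Lemma linspan_orthoproj v : linspan (range e) v <-> orthoproj e v = v.
Proof.
split=> [[m [w [c [ew ->]]]]|<-]; last first.
  by apply: linspan_sum => i; apply: subset_linspan; exists i.
(* Each [w j] is some [e i], so after exchanging the sums only that index survives. *)
rewrite /orthoproj; under eq_bigr do rewrite inner_suml scaler_suml.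
rewrite exchange_big /=; apply: eq_bigr => j _.
have [i _ <-] := ew j; rewrite (bigD1 i)//= innerZl orth_e eqxx mulr1 big1 ?addr0//.
by move=> l li; rewrite innerZl orth_e eq_sym (negbTE li) mulr0 scale0r.
Qed.

(** Bessel's inequality: the projection is self-adjoint and idempotent, so the squared norm of the
    residual is the difference of the two sides. *)
Lemma orthoproj_le v : '<orthoproj e v, orthoproj e v> <= '<v, v>.
Proof.
have PP : '<v, orthoproj e v> = '<orthoproj e v, orthoproj e v>.
  by rewrite inner_orthoproj orthoproj_idem.
have := inner_ge0 (v - orthoproj e v).
by rewrite innerBl !innerBr /= (innerC _ v) PP subrr subr0 subr_ge0.
Qed.

Lemma orthonormal_fcons u : unit_sphere H u -> (forall i, '<u, e i> = 0) ->
  orthonormal_family (fcons u e).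
Proof.
rewrite unit_sphereE => u1 ue i j.
case: (unliftP ord0 i) => [i'|] ->; case: (unliftP ord0 j) => [j'|] ->.
- by rewrite !fcons_lift orth_e (inj_eq lift_inj).
- by rewrite fcons_lift fcons0 innerC ue.
- by rewrite fcons_lift fcons0 ue.
- by rewrite fcons0 u1 eqxx.
Qed.

Lemma orthonormal_linearly_independent : linearly_independent e.
Proof. by move=> c c0 i; rewrite -(inner_comb c) c0 inner0l. Qed.

End Family.

(** Induction on the family, treating its head last. The [x i] may be dependent, hence only
    [k <= n]; this bound later gives the dimension estimate. *)
Lemma gram_schmidt n (x : 'I_n -> H) :
  exists k (e : 'I_k -> H), [/\ (k <= n)%N, orthonormal_family e &
    linspan (range e) = linspan (range x)].
Proof.
elim: n x => [|n IH] x; first by exists 0, x; split=> // -[].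
have [k [e [kn orth_e span_e]]] := IH (fun i => x (lift ord0 i)).
rewrite (fcons_eta x) range_fcons.
set y := x ord0; set r := y - orthoproj e y.
rewrite -(linspan_setU [set y] span_e).
(* A zero residual means that [y] already lies in the span of [e], which then need not grow. *)
have [r0|r0] := eqVneq r 0.
  exists k, e; split=> //; first exact: leqW.
  rewrite linspan_setU_id//; apply/(linspan_orthoproj orth_e)/esym/eqP.
  by rewrite -subr_eq0 -/r r0.
have rr : 0 < '<r, r> := inner_gt0 r0.
(* The factor that normalises the residual. *)
pose a := (Num.sqrt '<r, r>)^-1.
have a0 : a != 0 by rewrite invr_eq0 gt_eqF// sqrtr_gt0.
exists k.+1, (fcons (a *: r) e); split=> //.
  apply: orthonormal_fcons => //.
    rewrite unit_sphereE innerZl innerZr mulrA -expr2 exprVn sqr_sqrtr ?ltW//.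
    by rewrite mulVf ?gt_eqF.
  by move=> i; rewrite innerZl innerBl orthoproj_inner// subrr mulr0.
have Pe (B : set H) : linspan (B `|` range e) (orthoproj e y).
  by apply: linspan_sum => i; apply: subset_linspan; right; exists i.
rewrite range_fcons; apply/seteqP; split; apply: linspan_subset => w.
  case=> [->|we]; last by apply: subset_linspan; right.
  apply/linspanZ/linspanD; first by apply: subset_linspan; left.
  by rewrite -scaleN1r; apply/linspanZ/Pe.
case=> [->|we]; last by apply: subset_linspan; right.
(* The head is recovered as residual plus projection. *)
suff : linspan (a *: r |` range e) (a^-1 *: (a *: r) + orthoproj e y).
  by rewrite scalerK// subrK.
by apply: linspanD (Pe _); apply: linspanZ; apply: subset_linspan; left.
Qed.

End Orthonormal.

(** * Continuity on segments and compactness of Euclidean spheres *)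

Section Analysis.
Context {R : realType}.

(** Both continuity hypotheses are relative, because [acos] and [phi] are controlled only on
    segments. *)
Lemma within_continuous_comp_within (T : topologicalType) (A : set T)
    (B : set R) (f : T -> R) (g : R -> R) :
  (forall t, A t -> B (f t)) -> {within A, continuous f} ->
  {within B, continuous g} -> {within A, continuous (g \o f)}.
Proof.
move=> AB /subspace_continuousP cf /subspace_continuousP cg.
apply/subspace_continuousP => t At.
move=> P PP. have BP := cg _ (AB _ At) _ PP.
have := cf _ At _ BP; rewrite /nbhs /= /within /=.
by apply: filterS => s Ps As; apply: Ps => //; exact: AB.
Qed.

(** The inverse of a continuous decreasing function on a segment is continuous; the endpoints are
    rewritten as values of [cos] at [pi] and [0]. *)
Lemma within_continuous_acos : {within `[(-1), 1], continuous (@acos R)}.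
Proof.
rewrite -(@cospi R) -(@cos0 R); apply: segment_can_ge_continuous.
- exact: pi_ge0.
- by apply: continuous_subspaceT; exact: continuous_cos.
- exact: cosK.
Qed.

(** Differentiability settles positive points, but fails at [0] when [p < 1], so the right limit
    there is taken separately. *)
Lemma within_continuous_powR (p b : R) : 0 < p -> 0 < b ->
  {within `[0, b], continuous (fun t => t `^ p)}.
Proof.
move=> p0 b0.
have cpow (t : R) : 0 < t -> {for t, continuous (fun t => t `^ p)}.
  move=> t0; apply: differentiable_continuous; apply/derivable1_diffP.
  by apply: derivable_powR; rewrite in_itv/= t0.
apply/continuous_within_itvP => //; split.
- by move=> t; rewrite in_itv/= => /andP[t0 _]; exact: cpow.
- by rewrite powR0 ?gt_eqF//; exact: powR_cvg0.
- by apply: cvg_at_left_filter; exact: cpow.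
Qed.

Lemma compact_rV_sphere k : compact [set c : 'rV[R]_k | \sum_j c 0 j ^+ 2 = 1].
Proof.
apply: bounded_closed_compact.
  (* The norm on row vectors is the largest absolute entry, and the square of each entry is one term
     of a sum equal to [1]. *)
  exists 1; split=> // M M1 c /= c1; rewrite /Num.norm/= mx_normrE.
  apply: bigmax_le; first by rewrite ltW// (lt_trans ltr01).
  move=> [i j] _ /=; rewrite (ord1 i) (le_trans _ (ltW M1))//.
  rewrite -(@ler_pXn2r _ 2%N) ?nnegrE// expr1n real_normK ?num_real// -c1 (bigD1 j)//= lerDl.
  by apply: sumr_ge0 => l _; exact: sqr_ge0.
rewrite (_ : [set _ | _] = (fun c : 'rV[R]_k => \sum_j c 0 j ^+ 2) @^-1` [set 1]).
  apply: preimage_closed; last exact: closed_eq.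
  move=> c _; apply: continuous_big => [|j _]; first exact: add_continuous.
  move=> d; have cj := @coord_continuous R 1 k 0 j d; exact: (cvgM cj cj).
by [].
Qed.

End Analysis.

(** * Minimising the Fréchet function over a finite-dimensional subsphere *)

Section FrechetFun.
Context {R : realType} {H : hilbertType R}.
Context {n : nat} {x : 'I_n -> H} (x_sphere : forall i, unit_sphere H (x i)).

Lemma eq_frechet_fun (phi : R -> R) (s t : H) :
  (forall i, '<s, x i> = '<t, x i>) -> frechet_fun x phi s = frechet_fun x phi t.
Proof.
by move=> st; congr (_ * _); apply: eq_bigr => i _; rewrite /arc_dist st.
Qed.

Lemma unit_sphere_comb k (e : 'I_k -> H) (c : 'rV[R]_k) :
  orthonormal_family e ->
  unit_sphere H (\sum_j c 0 j *: e j) = (\sum_j c 0 j ^+ 2 = 1).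
Proof. by move=> orth_e; rewrite unit_sphereE inner_comb2. Qed.

(** The inner products with the [x i] are linear in the coordinates. On the sphere they stay in
    [[-1, 1]], where [acos] is continuous with values in [[0, pi]], where [phi] is continuous. *)
Lemma within_continuous_frechet k (e : 'I_k -> H) (phi : R -> R) :
  orthonormal_family e -> {within `[0, pi], continuous phi} ->
  {within [set c : 'rV[R]_k | \sum_j c 0 j ^+ 2 = 1],
    continuous (fun c => frechet_fun x phi (\sum_j c 0 j *: e j))}.
Proof.
move=> orth_e cphi; pose K : set 'rV[R]_k := [set c | \sum_j c 0 j ^+ 2 = 1].
pose psi i (c : 'rV[R]_k) := '<\sum_j c 0 j *: e j, x i>.
have psiK i c : K c -> -1 <= psi i c <= 1.
  by move=> Kc; apply: unit_inner_itv => //; rewrite unit_sphere_comb.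
have cpsi i : continuous (psi i).
  rewrite (_ : psi i = fun c => \sum_j c 0 j * '<e j, x i>); last first.
    apply: funext => c; rewrite /psi inner_suml.
    by apply: eq_bigr => j _; rewrite innerZl.
  apply: continuous_big => [|j _ c]; first exact: add_continuous.
  exact: (cvgM (@coord_continuous R 1 k 0 j c) (cvg_cst _)).
have cacos i : {within K, continuous (@acos R \o psi i)}.
  apply: (within_continuous_comp_within (B := `[(-1), 1]%classic)).
  - by move=> c Kc; rewrite /= in_itv/=; exact: psiK.
  - exact: continuous_subspaceT.
  - exact: within_continuous_acos.
have cterm i : {within K, continuous (phi \o (@acos R \o psi i))}.
  apply: (within_continuous_comp_within (B := `[0, pi]%classic)) => //.
  move=> c Kc; rewrite /= in_itv/= acos_ge0 ?acos_lepi//; exact: psiK.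
apply/subspace_continuousP => c Kc; apply: cvgM; first exact: cvg_cst.
apply: cvg_big => [|i _]; first exact: add_continuous.
exact: (iffLR (subspace_continuousP _ _) (cterm i)).
Qed.

Lemma frechet_minimiser_subsphere k (e : 'I_k.+1 -> H) (phi : R -> R) :
  orthonormal_family e -> {within `[0, pi], continuous phi} ->
  exists s, minimiser (frechet_fun x phi)
    (linspan (range e) `&` unit_sphere H) s.
Proof.
move=> orth_e cphi.
(* The index [k.+1] provides a first basis vector, so the sphere is nonempty and the extreme value
   theorem applies. *)
have K0 : [set c : 'rV[R]_k.+1 | \sum_j c 0 j ^+ 2 = 1] !=set0.
  exists (delta_mx 0 0); rewrite /= (bigD1 ord0)//= mxE !eqxx expr1n.
  rewrite big1 ?addr0// => j /negbTE j0.
  by rewrite mxE j0 andbF expr0n.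
have [c] := compact_EVT_min K0 (@compact_rV_sphere R k.+1)
  (within_continuous_frechet orth_e cphi).
rewrite inE => Kc minc.
exists (\sum_j c 0 j *: e j); split.
  split; last by rewrite unit_sphere_comb.
  by apply: linspan_sum => i; apply: subset_linspan; exists i.
move=> t [/(linspan_orthoproj orth_e) tP t1].
(* A competitor in the span equals its projection, hence is reached by its own coordinates. *)
have tE : \sum_j (\row_j '<t, e j>) 0 j *: e j = t.
  by rewrite -[RHS]tP; apply: eq_bigr => j _; rewrite mxE.
have := minc (\row_j '<t, e j>); rewrite tE; apply.
by rewrite inE /= -(unit_sphere_comb _ orth_e) tE.
Qed.

Lemma subsphere_same_inner k (e : 'I_k -> H) (u s : H) :
  orthonormal_family e -> unit_sphere H u -> (forall i, '<u, e i> = 0) ->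
  unit_sphere H s ->
  exists2 t, (linspan (u |` range e) `&` unit_sphere H) t &
    forall v, linspan (range e) v -> '<t, v> = '<s, v>.
Proof.
move=> orth_e u1 ue s1.
have up v : '<u, orthoproj e v> = 0.
  by rewrite inner_sumr big1// => i _; rewrite innerZr ue mulr0.
pose q := '<orthoproj e s, orthoproj e s>; pose a := Num.sqrt (1 - q).
have aE : a ^+ 2 = 1 - q.
  (* The radicand is nonnegative by Bessel's inequality, as [s] has norm [1]. *)
  rewrite sqr_sqrtr// subr_ge0 /q; move: s1; rewrite unit_sphereE => <-.
  exact: orthoproj_le.
exists (orthoproj e s + a *: u).
  split.
    apply: linspanD; last by apply/linspanZ/subset_linspan; left.
    by apply: linspan_sum => i; apply: subset_linspan; right; exists i.
  move: u1; rewrite !unit_sphereE => u1.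
  rewrite innerDl !innerDr !innerZl !innerZr u1 (innerC _ u) up -/q.
  by rewrite !mulr0 addr0 add0r mulr1 -expr2 aE addrC subrK.
move=> v /(linspan_orthoproj orth_e) <-.
by rewrite innerDl innerZl up mulr0 addr0 inner_orthoproj orthoproj_idem.
Qed.

End FrechetFun.

Theorem theorem2 (R : realType) (H : hilbertType R)
    (H_inf : infinite_dimensional H) (H_sep : separable H)
    (n : nat) (n_ge1 : (1 <= n)%N)
    (x : 'I_n -> H) (x_sphere : forall i, unit_sphere H (x i))
    (u : H) (u_orth : (orthocomp (linspan (range x)) `&` unit_sphere H) u) :
  [/\ (* (1) *)
      forall phi : R -> R, {within `[0, pi], continuous phi} ->
        exists s : H,
          [/\ (linspan (u |` range x) `&` unit_sphere H) s,
              minimiser (frechet_fun x phi) (unit_sphere H) s &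
              frechet_fun x phi s = inf (frechet_fun x phi @` unit_sphere H)],
      (* (2) *)
      forall p : R, 0 < p ->
        (exists2 s : H, (linspan (u |` range x) `&` unit_sphere H) s &
           Lp_centre_of_mass x p s) /\
        (exists2 m : nat, (m <= n)%N &
           sphere_dim m (linspan (u |` range x) `&` unit_sphere H)) &
      (* (3) *)
      forall phi : R -> R, {within `[0, pi], continuous phi} ->
        forall s : H, minimiser (frechet_fun x phi) (unit_sphere H) s ->
        '<s, u> != 0 ->
        exists s1 s2 : H,
          [/\ s1 != s2, minimiser (frechet_fun x phi) (unit_sphere H) s1 &
              minimiser (frechet_fun x phi) (unit_sphere H) s2]].
Proof.
have [u_perp u1] := u_orth.
have [k [e [kn orth_e span_e]]] := gram_schmidt x.
have xe i : linspan (range e) (x i).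
  by rewrite span_e; apply: subset_linspan; exists i.
have ue i : '<u, e i> = 0.
  by apply: u_perp; rewrite -span_e; apply: subset_linspan; exists i.
have ux i : '<u, x i> = 0 by apply: u_perp; rewrite -span_e.
have orth_ue := orthonormal_fcons orth_e u1 ue.
have span_ue : linspan (range (fcons u e)) = linspan (u |` range x).
  by rewrite range_fcons; exact: linspan_setU.
have exists_min (phi : R -> R) : {within `[0, pi], continuous phi} ->
    exists2 s, (linspan (u |` range x) `&` unit_sphere H) s &
      minimiser (frechet_fun x phi) (unit_sphere H) s.
  move=> cphi.
  have [s []] := frechet_minimiser_subsphere x_sphere orth_ue cphi.
  rewrite span_ue => Ws mins; exists s => //; split=> [|t t1]; first by case: Ws.
  (* Any competitor [t] on the whole sphere is moved into the subsphere without changing the value,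
     so the minimiser found there is global. *)
  have [t' Wt' tt'] := subsphere_same_inner orth_e u1 ue t1.
  rewrite -(@eq_frechet_fun R H n x phi t' t) => [|i]; last exact: tt'.
  by apply: mins; rewrite -span_ue range_fcons.
split=> [phi cphi|p p0|phi cphi s [s1 mins] su].
- have [s Ws mins] := exists_min phi cphi; exists s; split=> //.
  have lb : lbound (frechet_fun x phi @` unit_sphere H) (frechet_fun x phi s).
    by move=> _ [t t1 <-]; apply: mins.2.
  apply/eqP; rewrite eq_le lb_le_inf//=; last first.
    by exists (frechet_fun x phi s), s => //; exact: mins.1.
  by apply: ge_inf; [exists (frechet_fun x phi s)|exists s => //; exact: mins.1].
- split; last first.
    (* The [k.+1] independent vectors of [fcons u e] give a sphere of dimension [k], at most [n]. *)
    exists k => //; exists (linspan (u |` range x)) => //.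
    by exists (fcons u e) => //; exact: orthonormal_linearly_independent.
  (* The case where [phi] is the [p]-th power on [[0, pi]]. *)
  exact: (exists_min _ (within_continuous_powR p0 (pi_gt0 R))).
(* The reflection of [s] negates the inner product with [u]; coincidence with [s] would force that
   product to vanish. *)
pose s' := s - (2 * '<s, u>) *: u.
have uu : '<u, u> = 1 by rewrite -unit_sphereE.
exists s, s'; split=> //.
  apply: contraNneq su => ss'.
  have : '<s', u> = - '<s, u> by rewrite innerBl innerZl uu; ring.
  by rewrite -ss'; lra.
split=> [|t t1].
  move: s1; rewrite !unit_sphereE => s1.
  rewrite innerBl !innerBr !innerZl !innerZr s1 (innerC u s) uu; ring.
rewrite (@eq_frechet_fun R H n x phi _ s); first exact: mins.
by move=> i; rewrite innerBl innerZl ux mulr0 subr0.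
Qed.
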